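(* Let $a,b\in(0,1)$ be fixed. For any $n$ (a positive integer), there exist exactly $\phi(n)$ distinct admissible patterns of cardinality (length) $n$, where $\phi$ is Euler's totient function and patterns that are cyclic shifts of each other are regarded as the same pattern.
   Context: For $a,b\in(0,1)$ and $\mu\in(0,1)$ consider the map $f_\mu:\mathbb{R}\to\mathbb{R}$, $f_\mu(x)=ax+\mu$ if $x\le 0$, and $f_\mu(x)=bx+\mu-1$ if $x>0$. (This is the map $x\mapsto ax+\mu$ for $x\le0$, $x\mapsto bx+\mu+l$ for $x>0$, with $l=-1$ and $0<\mu<-l$.) A point $p$ is periodic of period $k$ if $f_\mu^k(p)=p$ and $k$ is the smallest such positive integer; its orbit, which consists of $k$ points, is then a periodic orbit of period $k$. Let $\mathcal{L}=(-\infty,0]$ and $\mathcal{R}=(0,\infty)$. A periodic orbit $x_0,x_1,\dots,x_{k-1}$ of period $k$ is coded by the string $\sigma=\sigma_0\cdots\sigma_{k-1}$ with $\sigma_i=\mathcal{L}$ if $x_i\in\mathcal{L}$ and $\sigma_i=\mathcal{R}$ if $x_i\in\mathcal{R}$. This string, considered up to cyclic shift (and repeated periodically along the orbit), is called the pattern of the orbit; its length (cardinality) $|\sigma|$ is the period $k$ of the orbit. For a pattern $\sigma$, $\mathcal{P}_\sigma$ denotes the set of parameters $\mu$ for which $f_\mu$ has a periodic orbit with pattern $\sigma$. The pattern $\sigma$ is called admissible (for the given $a,b$) if $\mathcal{P}_\sigma\neq\emptyset$.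
   Formalization: The count is stated for n at least 2: for n = 1 and 0 < μ < 1 the map has no fixed point (μ/(1-a) > 0 and (μ-1)/(1-b) < 0), so there are 0 admissible patterns of length 1, while φ(1) = 1. *)

(* Defs.v *)
From HB Require Import structures.
From mathcomp Require Import all_boot all_order all_algebra.
From mathcomp Require Import boolp classical_sets reals.
From mathcomp Require Import lra.

Set Implicit Arguments.
Unset Strict Implicit.
Unset Printing Implicit Defensive.

Import Order.TTheory GRing.Theory Num.Theory.

Local Open Scope ring_scope.

Definition pwl_map (R : realType) (a b mu x : R) : R :=
  if x <= 0 then a * x + mu else b * x + mu - 1.

Definition has_period (T : Type) (f : T -> T) (k : nat) (p : T) : Prop :=
  [/\ (0 < k)%N, iter k f p = p &
      forall j : nat, (0 < j < k)%N -> iter j f p <> p].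

Variant side := SideL | SideR.

Definition bool_of_side (s : side) : bool := if s is SideL then true else false.
Definition side_of_bool (b : bool) : side := if b then SideL else SideR.

Lemma bool_of_sideK : cancel bool_of_side side_of_bool.
Proof. by case. Qed.

HB.instance Definition _ := Finite.copy side (can_type bool_of_sideK).

Definition code (R : realType) (x : R) : side := if x <= 0 then SideL else SideR.

Definition itinerary (R : realType) (f : R -> R) (n : nat) (x : R) :
  n.-tuple side := [tuple code (iter i f x) | i < n].

(* A pattern of length n is a class of words of length n modulo cyclic shift;
   it is represented by the set of all the words in the class. *)
Definition pattern (n : nat) (s : n.-tuple side) : {set n.-tuple side} :=
  [set rot_tuple i s | i : 'I_n]%SET.

(* Here n is both the length of s and the minimal period of the orbit. *)
Definition param_set (R : realType) (a b : R) (n : nat) (s : n.-tuple side) :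
  set R :=
  [set mu : R | 0 < mu < 1 /\
     exists x : R, has_period (pwl_map a b mu) n x /\
       pattern (itinerary (pwl_map a b mu) n x) = pattern s]%classic.

Definition admissible (R : realType) (a b : R) (n : nat) (s : n.-tuple side) :
  Prop := (param_set a b s !=set0)%classic.

Definition admissible_patterns (R : realType) (a b : R) (n : nat) :
  {set {set n.-tuple side}} :=
  [set pattern s | s : n.-tuple side & `[< admissible a b s >]]%SET.

(* For 0 < mu < 1 there is no fixed point, hence no pattern of length 1,
   whereas totient 1 = 1: the count by the totient only holds from n = 2 on. *)
Lemma card_admissible_patterns1 (R : realType) (a b : R) :
  0 < a < 1 -> 0 < b < 1 -> #|admissible_patterns a b 1| = 0%N.
Proof.
move=> /andP[a0 a1] /andP[b0 b1]; apply/eqP; rewrite cards_eq0.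
apply/eqP/setP => P; rewrite inE; apply/negP => /imsetP[s]; rewrite inE.
move=> /asboolP[mu [/andP[mu0 mu1] [x [[_ fx _] _]]]] _; move: fx.
by rewrite /= /pwl_map; case: ifPn => [x0|]; [|rewrite -ltNge => x0] => ?; nra.
Qed.

(* Main.v *)
(* On a periodic orbit f is injective, increasing on each side of 0, and sends
   every point on the right below every image of a point on the left.  Hence,
   if m of the n points lie on the right, f acts on the sorted orbit as the
   rotation k |-> k + m mod n: m is coprime to n, and it determines the pattern.
   Conversely, for m coprime to n, the n - 1 gaps between consecutive points of
   such an orbit are visited one after the other by the rotation, each gap being
   a or b times the previous one, so they are determined up to a common scale D;
   requiring the largest point on the left to be 0 then fixes D and mu. *)
Require Import Defs.
From mathcomp Require Import all_boot all_order all_algebra.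
From mathcomp Require Import boolp reals.
From mathcomp Require Import zify ring lra.

Set Implicit Arguments.
Unset Strict Implicit.
Unset Printing Implicit Defensive.

Import Order.TTheory GRing.Theory Num.Theory.

Local Open Scope ring_scope.

(** * Words of rotations and their cyclic classes *)

(** Coding of an orbit started at its lowest point: [(i * m) %% n] is the rank of the [i]-th
    iterate, and the [n - m] lowest ranks lie on the left. *)
Definition rotation_word (n m : nat) : n.-tuple side :=
  [tuple if ((i * m) %% n < n - m)%N then SideL else SideR | i < n].

Lemma modn_add_range (n k m : nat) : (k < n)%N -> (m < n)%N ->
  ((k + m) %% n = if k + m < n then k + m else k + m - n)%N.
Proof.
move=> kn mn; case: ltnP => h; first exact: modn_small.
by rewrite -{1}(subnK h) modnDr modn_small //; lia.
Qed.

Lemma pattern_rot (n : nat) (s : n.-tuple side) (i : 'I_n) :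
  pattern (rot_tuple i s) = pattern s.
Proof.
have n0 : (0 < n)%N by apply: leq_ltn_trans (ltn_ord i).
have rotrot (t : n.-tuple side) (j k : 'I_n) :
    rot_tuple j (rot_tuple k t) =
    rot_tuple (Ordinal (ltn_pmod (j + k) n0)) t.
  apply/val_inj => /=; rewrite rot_add_mod ?size_tuple ?(ltnW (ltn_ord _)) //.
  rewrite modn_add_range //; case: ltngtP => //= h.
  by rewrite h subnn rot0 rot_oversize // size_tuple.
have sub (t : n.-tuple side) (k : 'I_n) :
    pattern (rot_tuple k t) \subset pattern t.
  by apply/subsetP => w /imsetP[j _ ->]; rewrite rotrot; apply: imset_f.
apply/eqP; rewrite eqEsubset sub /=.
(* Rotating by [n - i] undoes rotating by [i]; the reduction modulo [n] is for [i = 0]. *)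
have lt_ni : ((n - i) %% n < n)%N by rewrite ltn_pmod.
have {1}-> : s = rot_tuple (Ordinal lt_ni) (rot_tuple i s); last exact: sub.
rewrite rotrot; apply/val_inj => /=.
by rewrite modnDml subnK ?modnn ?rot0 // ltnW.
Qed.

Lemma mem_pattern (n : nat) (s : n.-tuple side) : (0 < n)%N -> s \in pattern s.
Proof.
move=> n0; apply/imsetP; exists (Ordinal n0) => //.
by apply/val_inj; rewrite /= rot0.
Qed.

(** The letter at [i] is [SideR] exactly when the quotient [i * m %/ n] increases by one at the next
    index, so the count telescopes to [n * m %/ n]. *)
Lemma count_rotation_word (n m : nat) : (0 < n)%N -> (m <= n)%N ->
  count_mem SideR (rotation_word n m) = m.
Proof.
move=> n0 le_mn.
have step (i : nat) : (i.+1 * m %/ n =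
    i * m %/ n + ~~ ((i * m) %% n < n - m))%N.
  have [lt_mn|->] : (m < n \/ m = n)%N by lia.
    rewrite mulSn addnC divnD // (divn_small lt_mn) (modn_small lt_mn) addn0.
    by congr addn; rewrite -leqNgt leq_subLR addnC.
  by rewrite subnn ltn0 !mulnK // addn1.
have tele k : (\sum_(i < k) ~~ ((i * m) %% n < n - m) = k * m %/ n)%N.
  by elim: k => [|k IH]; rewrite ?big_ord0 ?div0n // big_ord_recr /= IH -step.
rewrite -[RHS](mulKn m n0) -tele -sum1_count big_mkcond /= big_map big_enum /=.
by apply: eq_bigr => i _; case: ltnP.
Qed.

(** The number of letters [SideR] is invariant under cyclic shift. *)
Lemma pattern_rotation_word_inj (n m1 m2 : nat) :
    (m1 < n)%N -> (m2 < n)%N ->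
  pattern (rotation_word n m1) = pattern (rotation_word n m2) -> m1 = m2.
Proof.
move=> lt1 lt2 eq_pat; have n0 : (0 < n)%N by lia.
have := mem_pattern (rotation_word n m1) n0; rewrite eq_pat => /imsetP[i _ eqw].
rewrite -(count_rotation_word n0 (ltnW lt1)).
rewrite -(count_rotation_word n0 (ltnW lt2)) eqw /=.
by apply/seq.permP; rewrite perm_rot.
Qed.

Lemma card_coprime_ord (n : nat) :
  #|[set m : 'I_n | coprime n m]| = totient n.
Proof.
rewrite totient_count_coprime big_mkord -sum1_card [RHS]big_mkcond /=.
by rewrite big_mkcond /=; apply: eq_bigr => i _; rewrite inE; case: coprime.
Qed.

(** * Construction of an orbit for each coprime [m] *)

(* [c k] is, up to scale, the gap between the points of ranks [k - 1] and [k] of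
   an orbit of [n] points, [m] of them on the right; the gap of rank [n - m], the
   only one to straddle 0, is excluded from the recursion. *)
Lemma exists_gaps (R : realFieldType) (a b : R) (n m : nat) :
    0 < a -> 0 < b -> (0 < m < n)%N -> coprime m n ->
  exists c : nat -> R, [/\ forall k, 0 < c k, c m = 1 &
    forall k, (0 < k < n)%N -> (k + m)%N != n ->
      c ((k + m) %% n)%N = (if (k < n - m)%N then a else b) * c k].
Proof.
move=> a0 b0 /andP[m0 lt_mn] /(coprimeP _ m0)[[u v] /= uv].
have {}uv : (u * m = 1 + v * n)%N by lia.
pose e k : R := if (k < n - m)%N then a else b.
(* Starting from the gap of rank [m], the walk [m, 2m, ...] modulo [n] reaches rank [k] at step
   [k * u %% n], [u] being the inverse of [m]; [C j] multiplies the ratios met before step [j]. *)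
pose C j : R := \prod_(1 <= t < j) e (t * m %% n)%N.
have um k : ((k * u) * m = k * v * n + k)%N.
  by rewrite -mulnA uv mulnDr muln1 mulnA addnC.
exists (fun k => C (k * u %% n)%N); split => [k||k /andP[k0 lt_kn] kmn].
- by apply: prodr_gt0 => t _; rewrite /e; case: ifP.
- rewrite mulnC uv addnC modnMDl modn_small; last by lia.
  by rewrite /C big_nil.
- have n0 : (0 < n)%N by lia.
  set j := (k * u %% n)%N.
  have jm : (j * m %% n = k)%N by rewrite modnMml um modnMDl modn_small.
  have j0 : (0 < j)%N.
    by case: (posnP j) => // j0; move: jm; rewrite j0 mod0n; lia.
  have lt_jn : (j < n)%N by rewrite ltn_pmod.
  have km0 : ((k + m) %% n != 0)%N by rewrite modn_add_range //; case: ifP; lia.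
  (* The walk can only end at the excluded rank [n - m], whose successor is 0. *)
  have lt_j1n : (j.+1 < n)%N.
    rewrite ltn_neqAle lt_jn andbT; apply: contraNneq km0 => j1n.
    by rewrite -[X in (X + _)%N]jm modnDml addnC -mulSn j1n modnMr.
  have -> : ((k + m) %% n * u %% n = j.+1)%N.
    rewrite modnMml mulnDl [(m * u)%N]mulnC uv addnA addnC modnMDl.
    by rewrite -modnDml addn1 modn_small.
  by rewrite /C big_nat_recr //= jm mulrC.
Qed.

Lemma exists_rotated_points (R : realType) (a b : R) (n m : nat) :
    0 < a < 1 -> 0 < b < 1 -> (0 < m < n)%N -> coprime m n ->
  exists (mu : R) (y : nat -> R),
    [/\ 0 < mu < 1, {homo y : i j / (i < j)%N >-> i < j},
        forall i, (y i <= 0) = (i < n - m)%N &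
        forall i, (i < n)%N -> pwl_map a b mu (y i) = y ((i + m) %% n)%N].
Proof.
move=> /andP[a0 a1] /andP[b0 b1] hmn co.
have [c [c0 cm cS]] := exists_gaps a0 b0 hmn co.
case/andP: hmn => m0 lt_mn.
(* Unscaled height of the point of rank [i] above the lowest one. [TL] and [TR] below express the
   action of the map on each side. *)
pose T i := \sum_(k < i) c k.+1.
have TS i : T i.+1 = T i + c i.+1 by rewrite /T big_ord_recr.
have T0 : T 0%N = 0 by rewrite /T big_ord0.
have T_homo : {homo T : i j / (i < j)%N >-> i < j}.
  by apply: homo_ltn => [? ? ?|i]; [exact: lt_trans | rewrite TS ltrDl].
have TL i : (i < n - m)%N -> T (i + m)%N = T m + a * T i.
  elim: i => [|i IH] lt_i; first by rewrite T0 mulr0 addr0.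
  rewrite addSn !TS IH; last by lia.
  have := cS i.+1; rewrite lt_i modn_small; last by lia.
  by rewrite addSn => ->; [ring | lia | lia].
have TR i : (i < m)%N -> T i = b * (T (i + (n - m))%N - T (n - m)%N).
  elim: i => [|i IH] lt_i; first by rewrite add0n T0; ring.
  rewrite addSn !TS IH; last by lia.
  have := cS (i + (n - m)).+1.
  rewrite (_ : ((i + (n - m)).+1 + m = i.+1 + n)%N); last by lia.
  rewrite modnDr modn_small; last by lia.
  by rewrite ifN => [->|]; [ring | lia | lia | lia].
(* Rank of the largest point on the left, to be placed at 0; its image [mu] then has rank [q + m],
   that is [n.-1]. *)
pose q := (n - m).-1.
have qE : q.+1 = (n - m)%N by rewrite prednK // subn_gt0.
have TqL : T n.-1 = T m + a * T q.
  by rewrite -TL; [congr T; lia | lia].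
have TmR : T m = 1 + b * (T n.-1 - T (n - m)%N).
  have -> : T m = T m.-1 + 1 by rewrite -{1}(prednK m0) TS (prednK m0) cm.
  by rewrite TR; [rewrite addrC; congr (1 + b * (T _ - _)); lia | lia].
have lt_qnm : T q < T (n - m)%N by apply: T_homo; lia.
have Tq0 : 0 <= T q.
  by rewrite -T0; case: (posnP q) => [->//|/T_homo/ltW].
have lt_Tqn : T q < T n.-1 by apply: T_homo; lia.
(* The lowest point on the right must be sent to the lowest point: [b * y (n - m) + mu - 1 = y 0]
   with [mu = y n.-1]. Solving for the scale gives [D]. *)
pose D := (T n.-1 + b * (T (n - m)%N - T q))^-1.
have den0 : 0 < T n.-1 + b * (T (n - m)%N - T q) by nra.
have D0 : 0 < D by rewrite invr_gt0.
have DE : D * (T n.-1 + b * (T (n - m)%N - T q)) = 1.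
  by rewrite mulVf // gt_eqF.
clearbody D.
pose y i := D * (T i - T q).
have y_le0 i : (y i <= 0) = (i < n - m)%N.
  rewrite /y pmulr_rle0 // subr_le0 -qE ltnS.
  by case: (ltngtP i q) => [/T_homo/ltW|/T_homo/lt_geF|->]; rewrite ?lexx.
exists (y n.-1), y; split => // [|i j lt_ij|i lt_in].
- have : 0 < D * (b * (T (n - m)%N - T q)) by rewrite !mulr_gt0 // subr_gt0.
  by rewrite /y; move=> ?; apply/andP; split; nra.
- by rewrite /y ltr_pM2l // ltrD2r T_homo.
- rewrite /pwl_map y_le0; case: ltnP => h.
    rewrite modn_small; last by lia.
    by rewrite /y TL // TqL; ring.
  rewrite (_ : (i + m = i - (n - m) + n)%N); last by lia.
  rewrite modnDr modn_small; last by lia.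
  have := TR (i - (n - m))%N; rewrite subnK // => TRi.
  rewrite /y TRi; last by lia.
  rewrite -DE; ring.
Qed.

Lemma pattern_rotation_word_admissible (R : realType) (a b : R) (n m : nat) :
    0 < a < 1 -> 0 < b < 1 -> (0 < m < n)%N -> coprime m n ->
  pattern (rotation_word n m) \in admissible_patterns a b n.
Proof.
move=> ha hb hmn co; have n0 : (0 < n)%N by lia.
have [mu [y [hmu y_homo y_le0 yS]]] := exists_rotated_points ha hb hmn co.
have iterE j : iter j (pwl_map a b mu) (y 0%N) = y (j * m %% n)%N.
  elim: j => [|j /= ->]; first by rewrite mul0n mod0n.
  by rewrite yS ?ltn_pmod // modnDml mulSn addnC.
apply: imset_f; rewrite inE; apply/asboolP; exists mu; split=> //.
exists (y 0%N); split; last first.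
  congr pattern; apply: eq_from_tnth => i.
  by rewrite !tnth_mktuple iterE /code y_le0.
split=> // [|j /andP[j0 lt_jn]]; rewrite iterE; first by rewrite modnMr.
have jm0 : (0 < j * m %% n)%N.
  rewrite lt0n -/(dvdn n (j * m)) Gauss_dvdl 1?coprime_sym //.
  by apply/negP => /(dvdn_leq j0); rewrite leqNgt lt_jn.
by apply/eqP; rewrite gt_eqF ?y_homo.
Qed.

(** * Every periodic orbit is a rotation on ranks *)

Lemma iter_mod_period (T : Type) (f : T -> T) (n : nat) (x : T) (k : nat) :
  iter n f x = x -> iter (k %% n) f x = iter k f x.
Proof.
move=> fx; rewrite {2}(divn_eq k n) addnC iterD; congr iter.
by elim: (k %/ n)%N => //= q IH; rewrite mulSn iterD -IH fx.
Qed.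

Lemma iter_period_inj (T : Type) (f : T -> T) (n : nat) (x : T) (i j : nat) :
  has_period f n x -> (i < n)%N -> (j < n)%N ->
  iter i f x = iter j f x -> i = j.
Proof.
move=> [n0 fx min_n]; wlog le_ij : i j / (i <= j)%N => [hw lti ltj eq_ij|].
  by case/orP: (leq_total i j) => h; [|symmetry]; apply: hw.
move=> lt_in lt_jn eq_ij; case: (ltngtP i j) le_ij => // lt_ij _.
case: (min_n (n - j + i)%N); first by lia.
by rewrite iterD eq_ij -iterD subnK // ltnW.
Qed.

(** The extreme points of the orbit are images of orbit points. Images of left points are at most
    [mu], those of right points exceed [mu - 1]; in the two other cases the contraction [a, b < 1]
    gives the bound. *)
Lemma periodic_orbit_range (R : realType) (a b mu : R) (n : nat) (x : R) :
    0 < a < 1 -> 0 < b < 1 -> 0 < mu < 1 -> has_period (pwl_map a b mu) n x ->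
  forall j, mu - 1 <= iter j (pwl_map a b mu) x <= mu.
Proof.
move=> /andP[a0 a1] /andP[b0 b1] /andP[mu0 mu1] [n0 fx _].
set f := pwl_map a b mu in fx *; pose X (i : 'I_n) := iter i f x.
have X_mod k : X (Ordinal (ltn_pmod k n0)) = iter k f x.
  exact: iter_mod_period.
have pre (i : 'I_n) : exists p : 'I_n, X i = f (X p).
  exists (Ordinal (ltn_pmod (i + n.-1) n0)); rewrite X_mod.
  by rewrite -iterS -addnS prednK // iterD fx.
move=> j; rewrite -X_mod; move: (Ordinal _) => {j} j.
apply/andP; split.
- have [i _ min_i] :=
    @Order.TotalTheory.arg_minP _ _ _ (Ordinal n0) xpredT X isT.
  apply: le_trans (min_i j isT); have [p Xi] := pre i.
  move: (min_i p isT); rewrite {}Xi /f /pwl_map.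
  by case: ifPn => Xp /= le_p; rewrite -?ltNge in Xp; nra.
- have [i _ max_i] :=
    @Order.TotalTheory.arg_maxP _ _ _ (Ordinal n0) xpredT X isT.
  apply: le_trans (max_i j isT) _; have [p Xi] := pre i.
  move: (max_i p isT); rewrite {}Xi /f /pwl_map.
  by case: ifPn => Xp /= le_p; rewrite -?ltNge in Xp; nra.
Qed.

Lemma pwl_map_lt (R : realType) (a b mu p q : R) :
    0 < a < 1 -> 0 < b < 1 -> 0 < mu < 1 ->
    mu - 1 <= p <= mu -> mu - 1 <= q <= mu ->
  (pwl_map a b mu p < pwl_map a b mu q) =
  (if q <= 0 then (0 < p) || (p < q) else (0 < p) && (p < q)).
Proof.
move=> /andP[a0 a1] /andP[b0 b1] /andP[mu0 mu1] /andP[p1 p2] /andP[q1 q2].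
(* In the extreme case this is [a * (1 - mu) + b * mu < 1], a convex combination of [a] and [b]. *)
have right_lt_left u v : mu - 1 <= u -> v <= mu -> b * v + mu - 1 < a * u + mu.
  by move=> hu hv; nra.
rewrite /pwl_map (ltNge 0 p); case: (lerP p 0) => hp; case: (lerP q 0) => hq /=.
- by rewrite ltrD2r ltr_pM2l.
- by apply/negbTE; rewrite -leNgt ltW // right_lt_left.
- by rewrite right_lt_left.
- by rewrite -!addrA ltrD2r ltr_pM2l.
Qed.

(** Ranks start at 0, and [j] may exceed [n], so that time indices need no reduction. *)
Definition orbit_rank (R : realType) (f : R -> R) (n : nat) (x : R) (j : nat) :=
  #|[set i : 'I_n | iter i f x < iter j f x]|.

(** Below the image of a left point lie the images of the [m] right points and of the points under
    it: the rank grows by [m]. Below the image of a right point lie only the images of right points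
    under it: the [n - m] left points drop out of the count. *)
Lemma orbit_rankP (R : realType) (a b mu : R) (n : nat) (x : R)
    (f := pwl_map a b mu) (m := #|[set i : 'I_n | 0 < iter i f x]|) (j : nat) :
    0 < a < 1 -> 0 < b < 1 -> 0 < mu < 1 -> has_period f n x ->
  (iter j f x <= 0) = (orbit_rank f n x j < n - m)%N /\
  orbit_rank f n x j.+1 = ((orbit_rank f n x j + m) %% n)%N.
Proof.
move=> ha hb hmu per; have range := periodic_orbit_range ha hb hmu per.
have [n0 fx _] := per.
pose A := [set i : 'I_n | 0 < iter i f x].
pose B := [set i : 'I_n | iter i f x < iter j f x].
have rS : orbit_rank f n x j.+1 =
    #|[set i : 'I_n | f (iter i f x) < f (iter j f x)]|.
  (* Reindexing by the cyclic successor: each orbit point is the image of the previous one. *)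
  rewrite -(card_imset _ (@ordS_inj n)) /orbit_rank; congr #|pred_of_set _|.
  apply/setP => i; apply/idP/imsetP => [|[k]]; rewrite !inE => lt_i.
    exists (ord_pred i); last by rewrite ord_predK.
    have := iter_mod_period (ord_pred i).+1 fx.
    by rewrite inE -[(_ %% n)%N]/(val (ordS (ord_pred i))) ord_predK => /= <-.
  by move=> ->; rewrite /= iter_mod_period.
have sub_m : (#|A| + #|~: A| = n)%N by rewrite cardsC card_ord.
have -> : m = #|A| by [].
have -> : orbit_rank f n x j = #|B| by [].
pose j' := Ordinal (ltn_pmod j n0).
have j'E : iter j' f x = iter j f x by rewrite /= iter_mod_period.
have AC : (n - #|A| = #|~: A|)%N by lia.
rewrite AC {}rS.
under eq_finset do rewrite pwl_map_lt //.
have A_C i : (i \in ~: A) = (iter i f x <= 0) by rewrite !inE -leNgt.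
case: (lerP (iter j f x) 0) => hj.
- have BA : B \proper ~: A.
    apply/properP; split; last by exists j'; rewrite ?A_C ?inE j'E ?ltxx.
    by apply/subsetP => i; rewrite A_C inE => /ltW/le_trans->.
  have ltB := proper_card BA.
  have -> : [set i : 'I_n | (0 < iter i f x) || (iter i f x < iter j f x)] =
      B :|: A.
    by apply/setP => i; rewrite !inE orbC.
  have := cardsUI B A.
  have -> : B :&: A = set0.
    apply/setP => i; rewrite !inE; apply/negP => /andP[lt_ij].
    by rewrite ltNge (ltW (lt_le_trans lt_ij hj)).
  by rewrite cards0 addn0 => ->; rewrite ltB modn_small //; lia.
- have -> : [set i : 'I_n | (0 < iter i f x) && (iter i f x < iter j f x)] =
      A :&: B.
    by apply/setP => i; rewrite !inE.
  have CB : ~: A \subset B.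
    by apply/subsetP => i; rewrite A_C inE => /le_lt_trans->.
  have leB := subset_leq_card CB.
  have UB : A :|: B = setT.
    apply/setP => i; rewrite [RHS]inE; apply/setUP.
    case: (boolP (i \in A)) => [|/[!(=^~ in_setC)] /(subsetP CB)];
      by [left|right].
  have := cardsUI A B; rewrite UB cardsT card_ord => eqn.
  rewrite ltnNge leB; split=> //.
  have AB : (#|A :&: B| < n)%N.
    have : (#|B| < n)%N.
      have : B \proper [set: 'I_n].
        by apply/properP; split; [exact: subsetT|exists j'];
          rewrite ?inE // j'E ltxx.
      by move/proper_card; rewrite cardsT card_ord.
    by apply: leq_ltn_trans; apply: subset_leq_card; apply: subsetIr.
  by rewrite addnC -eqn modnDl modn_small.
Qed.

Lemma rot_itinerary (R : realType) (f : R -> R) (n : nat) (x : R) (i : 'I_n) :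
  iter n f x = x ->
  rot_tuple i (itinerary f n x) = itinerary f n (iter i f x).
Proof.
move=> fx; have n0 : (0 < n)%N by apply: leq_ltn_trans (ltn_ord i).
have it_nth k : (k < n)%N -> nth SideL (itinerary f n x) k = code (iter k f x).
  by move=> lt_kn; rewrite -[k]/(val (Ordinal lt_kn)) -tnth_nth tnth_mktuple.
apply: eq_from_tnth => j; rewrite tnth_mktuple -iterD (tnth_nth SideL) /=.
rewrite /rot nth_cat size_drop size_map size_enum_ord.
have [lt_i lt_j] := (ltn_ord i, ltn_ord j).
case: ltnP => h.
  by rewrite nth_drop it_nth; [rewrite addnC | lia].
rewrite nth_take; last by lia.
rewrite it_nth; last by lia.
rewrite -(iter_mod_period (j + i) fx) modn_add_range // ifN; last by lia.
by congr (code (iter _ f x)); lia.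
Qed.

(** Read from the lowest point [i0], the ranks are the multiples of [m] modulo [n], so the itinerary
    there is the rotation word. *)
Lemma periodic_pattern (R : realType) (a b mu : R) (n : nat) (x : R) :
    0 < a < 1 -> 0 < b < 1 -> 0 < mu < 1 -> has_period (pwl_map a b mu) n x ->
  exists2 m : nat, (m <= n)%N && coprime n m &
    pattern (itinerary (pwl_map a b mu) n x) = pattern (rotation_word n m).
Proof.
move=> ha hb hmu per; have [n0 fx _] := per.
set f := pwl_map a b mu in per fx *.
pose m := #|[set i : 'I_n | 0 < iter i f x]|.
pose r := orbit_rank f n x.
have rP j := orbit_rankP j ha hb hmu per.
have le_mn : (m <= n)%N by rewrite -[X in (_ <= X)%N]card_ord max_card.
have [i0 _ min_i0] := @Order.TotalTheory.arg_minP _ _ _ (Ordinal n0) xpredT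
  (fun i : 'I_n => iter i f x) isT.
have r0 : r i0 = 0%N.
  apply/eqP; rewrite cards_eq0; apply/eqP/setP => i; rewrite !inE.
  by apply/negbTE; rewrite -leNgt min_i0.
have rE j : r (j + i0)%N = (j * m %% n)%N.
  elim: j => [|j IH]; first by rewrite mul0n mod0n add0n r0.
  by rewrite addSn /r (rP _).2 -/(r _) IH modnDml mulSn addnC.
have r_inj i j : (i < n)%N -> (j < n)%N -> r i = r j -> i = j.
  move=> lt_in lt_jn eq_r.
  have lt_rank k l : (k < n)%N -> iter k f x < iter l f x -> (r k < r l)%N.
    move=> lt_kn lt_kl; apply: proper_card; apply/properP; split.
      by apply/subsetP => s; rewrite !inE => /lt_trans->.
    by exists (Ordinal lt_kn); rewrite !inE ?ltxx.
  apply: (iter_period_inj per) => //.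
  case: (ltgtP (iter i f x) (iter j f x)) => // h.
  - by have := lt_rank _ _ lt_in h; rewrite eq_r ltnn.
  - by have := lt_rank _ _ lt_jn h; rewrite eq_r ltnn.
exists m.
  have r_mod k : r (k %% n)%N = r k by rewrite /r /orbit_rank iter_mod_period.
  (* The rank already returns after [q] steps; distinct points having distinct ranks, [n] divides
     [q], whence [d = 1]. *)
  rewrite le_mn /=; set d := gcdn n m; pose q := (n %/ d)%N.
  have d0 : (0 < d)%N by rewrite gcdn_gt0 n0.
  have nE : (n = q * d)%N by rewrite divnK ?dvdn_gcdl.
  have q0 : (0 < q)%N by lia.
  have r_q : r ((q + i0) %% n)%N = r ((0 + i0) %% n)%N.
    rewrite !r_mod !rE -(divnK (dvdn_gcdr n m)) -/d mulnCA -nE modnMl.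
    by rewrite mul0n mod0n.
  have /eqP := r_inj _ _ (ltn_pmod _ n0) (ltn_pmod _ n0) r_q.
  rewrite eqn_modDr mod0n => /(dvdn_leq q0); rewrite {1}nE.
  by rewrite /coprime -/d; nia.
rewrite -(pattern_rot _ i0) rot_itinerary //; congr pattern.
apply: eq_from_tnth => i; rewrite !tnth_mktuple /code -iterD (rP _).1.
by rewrite -/(r _) rE.
Qed.

Theorem theorem1 (R : realType) (a b : R) (ha : 0 < a < 1) (hb : 0 < b < 1)
  (n : nat) (hn : (1 < n)%N) :
  #|admissible_patterns a b n| = totient n.
Proof.
have n0 : (0 < n)%N by lia.
rewrite -card_coprime_ord.
rewrite -(card_in_imset (f := fun m : 'I_n => pattern (rotation_word n m))).
  congr #|pred_of_set _|; apply/setP => P; apply/imsetP/imsetP => [[s]|[m]].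
    rewrite inE => /asboolP[mu [hmu [x [per eq_pat]]]] ->.
    have [m /andP[le_mn co]] := periodic_pattern ha hb hmu per.
    rewrite eq_pat => ->.
    (* For [m = n] here, and [m = 0] in the converse, the gcd would be [n > 1]. *)
    have lt_mn : (m < n)%N.
      rewrite ltn_neqAle le_mn andbT; apply: contraTneq co => ->.
      by rewrite /coprime gcdnn; lia.
    by exists (Ordinal lt_mn); rewrite ?inE.
  rewrite inE => co ->; apply/imsetP.
  apply: pattern_rotation_word_admissible => //; last by rewrite coprime_sym.
  rewrite ltn_ord andbT lt0n; apply: contraTneq co => ->.
  by rewrite /coprime gcdn0; lia.
move=> m1 m2 _ _ /pattern_rotation_word_inj eq_m; apply/val_inj.
exact: eq_m.
Qed.
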